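(* Let $V$ be a control Lyapunov function on $\mathcal{D}$ (with class $\mathcal{K}$ function $\alpha_l$) for the system $\dot{\mathbf{x}}=\mathbf{f}(\mathbf{x})+\mathbf{G}(\mathbf{x})\mathbf{u}$, and let $h$ be a control barrier function of $\mathcal{C}=\{\mathbf{x}\in\mathbb{R}^n : h(\mathbf{x})\ge 0\}\subset\mathcal{D}$ on $\mathcal{D}$ (with extended class $\mathcal{K}$ function $\alpha_h$), such that $h(\mathbf{0})>0$ and $\mathcal{L}_{\mathbf{G}}h(\mathbf{x})\ne\mathbf{0}$ for all $\mathbf{x}\in\mathcal{D}$. Let $\mathbf{w}_p:\mathcal{D}\to\mathbb{R}^m$ be locally Lipschitz with $\mathcal{L}_{\mathbf{G}}h(\mathbf{x})\mathbf{w}_p(\mathbf{x})=0$ and $\mathbf{G}(\mathbf{x})\mathbf{w}_p(\mathbf{x})\neq\mathbf{0}$ for all $\mathbf{x}\in\mathcal{D}\setminus\{\mathbf{0}\}$. Consider the system with the CLF-CBF-DCP control law $\mathbf{u}=\mathbf{w}_l\bar u_l+\mathbf{w}_h\bar u_h$ with gain $k\in\mathbb{R}$ (defined in the context), let $\mathbf{F}_u$, $\Omega$ and $\mathcal{X}$ be as defined in the context, and assume $\mathcal{X}\neq\emptyset$. Let $\nu>0$ and suppose that $$k>\frac{\sup_{\mathbf{x}\in\mathcal{X}}\|\mathbf{F}_u(\mathbf{x})\|}{\nu\,\inf_{\mathbf{x}\in\mathcal{X}}\|\mathbf{G}(\mathbf{x})\mathbf{w}_p(\mathbf{x})\|}$$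 (in particular, the supremum is finite and the infimum is positive). Then every equilibrium $\mathbf{x}^*\in\mathcal{D}\setminus\{\mathbf{0}\}$ of the closed-loop system lies in $$\mathcal{Q}:=\{\mathbf{x}\in\Omega : 0<\bar u_h(\mathbf{x})<\nu\}\subset\partial\mathcal{C}$$ and satisfies $$-\mathbf{F}_u(\mathbf{x}^* )=\bar u_h(\mathbf{x}^* )\,k\,\mathbf{G}(\mathbf{x}^* )\mathbf{w}_p(\mathbf{x}^* ).$$
   Context: Setting. The control-affine system is $\dot{\mathbf{x}}=\mathbf{f}(\mathbf{x})+\mathbf{G}(\mathbf{x})\mathbf{u}$ with state $\mathbf{x}\in\mathbb{R}^n$ and input $\mathbf{u}\in\mathbb{R}^m$, where $\mathbf{f}:\mathbb{R}^n\to\mathbb{R}^n$ and $\mathbf{G}:\mathbb{R}^n\to\mathbb{R}^{n\times m}$ are locally Lipschitz continuous, $\mathbf{f}(\mathbf{0})=\mathbf{0}$, and $\operatorname{rank}\mathbf{G}(\mathbf{x})\ge2$ for $\mathbf{x}\in\mathcal{D}\setminus\{\mathbf{0}\}$. The set $\mathcal{D}\subseteq\mathbb{R}^n$ is open and connected with $\mathbf{0}\in\mathcal{D}$. Notation. For a continuously differentiable $\phi:\mathbb{R}^n\to\mathbb{R}$, $\mathcal{L}_{\mathbf{f}}\phi=\nabla \phi^\top\mathbf{f}$ and $\mathcal{L}_{\mathbf{G}}\phi=\nabla \phi^\top\mathbf{G}$ (a row vector). $(s)_+=\max(s,0)$; $\|\cdot\|$ is the Euclidean norm; $\partial\mathcal{C}$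 is the boundary of $\mathcal{C}$. For vectors, $\mathbf{a}\parallel\mathbf{b}$ means that $\mathbf{a},\mathbf{b}$ are linearly dependent and point in the same direction. A class $\mathcal{K}$ function $\mathbb{R}_{\ge0}\to\mathbb{R}_{\ge0}$ is continuous, strictly increasing and zero at $0$; an extended class $\mathcal{K}$ function $\mathbb{R}\to\mathbb{R}$ is continuous, strictly increasing and zero at $0$. Control Lyapunov function (CLF). A continuously differentiable positive-definite $V:\mathbb{R}^n\to\mathbb{R}$ is a CLF on $\mathcal{D}$ if there is a class $\mathcal{K}$ function $\alpha_l$ with $\inf_{\mathbf{u}\in\mathbb{R}^m}[\mathcal{L}_{\mathbf{f}}V(\mathbf{x})+\mathcal{L}_{\mathbf{G}}V(\mathbf{x})\mathbf{u}]\le-\alpha_l(V(\mathbf{x}))$ for each $\mathbf{x}\in\mathcal{D}\setminus\{\mathbf{0}\}$. Control barrier function (CBF). A continuously differentiable $h:\mathbb{R}^n\to\mathbb{R}$ is a CBF of $\mathcal{C}=\{\mathbf{x}:h(\mathbf{x})\ge0\}$ on $\mathcal{D}$ if there is an extended class $\mathcal{K}$ function $\alpha_h$ with $\sup_{\mathbf{u}\in\mathbb{R}^m}[\mathcal{L}_{\mathbf{f}}h(\mathbf{x})+\mathcal{L}_{\mathbf{G}}h(\mathbf{x})\mathbf{u}]\ge-\alpha_h(h(\mathbf{x}))$ for all $\mathbf{x}\in\mathcal{D}$. CLF-CBF-DCP control law. Let $F_l:=\mathcal{L}_{\mathbf{f}}V+\alpha_l(V)$ and $F_h:=\mathcal{L}_{\mathbf{f}}h+\alpha_h(h)$.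 For $k\in\mathbb{R}$ set $$\mathbf{w}_l(\mathbf{x})=-\mathcal{L}_{\mathbf{G}}V(\mathbf{x})^\top,\qquad \mathbf{w}_h(\mathbf{x})=\mathcal{L}_{\mathbf{G}}h(\mathbf{x})^\top+k\,\mathbf{w}_p(\mathbf{x}),$$ $$\bar u_l=\begin{cases}-\dfrac{F_l(\mathbf{x})}{\mathcal{L}_{\mathbf{G}}V(\mathbf{x})\mathbf{w}_l},&F_l(\mathbf{x})>0,\\ 0,&F_l(\mathbf{x})\le0,\end{cases}\qquad \bar u_h=\left(-\frac{F_h(\mathbf{x})+\mathcal{L}_{\mathbf{G}}h(\mathbf{x})\mathbf{w}_l\bar u_l}{\mathcal{L}_{\mathbf{G}}h(\mathbf{x})\mathbf{w}_h}\right)_+,$$ and $\mathbf{u}=\mathbf{w}_l\bar u_l+\mathbf{w}_h\bar u_h$. The closed-loop system on $\mathcal{D}$ is $\dot{\mathbf{x}}=\mathbf{f}(\mathbf{x})+\mathbf{G}(\mathbf{x})[\mathbf{w}_l\bar u_l+\mathbf{w}_h\bar u_h]=\mathbf{F}_u(\mathbf{x})+\bar u_h k\,\mathbf{G}(\mathbf{x})\mathbf{w}_p(\mathbf{x})$, where $$\mathbf{F}_u(\mathbf{x}):=\mathbf{f}(\mathbf{x})+\mathbf{G}(\mathbf{x})\left[-\mathcal{L}_{\mathbf{G}}V(\mathbf{x})^\top\bar u_l+\mathcal{L}_{\mathbf{G}}h(\mathbf{x})^\top\bar u_h\right].$$ An equilibrium is a point where the right-hand side vanishes. Sets. $$\Omega:=\{\mathbf{x}\in\partial\mathcal{C}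 : -\mathbf{F}_u(\mathbf{x})\parallel\mathbf{G}(\mathbf{x})\mathbf{w}_p(\mathbf{x}),\ \mathbf{F}_u(\mathbf{x})\ne\mathbf{0}\},\qquad \mathcal{X}:=\{\mathbf{x}\in\Omega : \bar u_h(\mathbf{x})>0\}.$$ (Since $\mathcal{L}_{\mathbf{G}}h\,\mathbf{w}_p=0$ on $\mathcal{D}\setminus\{\mathbf{0}\}$, the values $\bar u_l,\bar u_h,\mathbf{F}_u$ there, and hence $\Omega$ and $\mathcal{X}$, do not depend on $k$.) *)

(* Defs.v *)
From mathcomp Require Export all_boot all_order all_algebra.
From mathcomp Require Export all_classical all_reals all_analysis.

Set Implicit Arguments.
Unset Strict Implicit.
Unset Printing Implicit Defensive.

Export Order.TTheory GRing.Theory Num.Theory.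
Export numFieldNormedType.Exports.

Local Open Scope classical_set_scope.
Local Open Scope ring_scope.

(* The norm `|v| that MathComp-Analysis puts on matrices is the sup norm. The
   topology and the locally Lipschitz functions are the same for both norms. *)
Definition enorm (R : realType) (n : nat) (v : 'cV[R]_n) : R :=
  Num.sqrt (\sum_(i < n) v i 0 ^+ 2).

Definition parallel (R : realType) (n : nat) (a b : 'cV[R]_n) : Prop :=
  exists2 c : R, 0 < c & a = c *: b.

Definition boundary (T : topologicalType) (A : set T) : set T :=
  closure A `\` interior A.

(* A function from [0, +oo[ to itself, given by a total function whose values on
   the negative reals are unconstrained. *)
Definition classK (R : realType) (alpha : R -> R) : Prop :=
  [/\ {within [set s : R | 0 <= s], continuous alpha},
      forall s t : R, 0 <= s -> s < t -> alpha s < alpha t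
    & alpha 0 = 0].

Definition extended_classK (R : realType) (alpha : R -> R) : Prop :=
  [/\ continuous alpha, {homo alpha : s t / s < t} & alpha 0 = 0].

Section Calculus.
Context {R : realType} {n : nat}.
Implicit Types (phi : 'cV[R]_n -> R) (x : 'cV[R]_n).

Definition grad phi x : 'cV[R]_n := \col_i 'D_(delta_mx i 0) phi x.

Definition C1 phi : Prop :=
  (forall x, differentiable phi x) /\ continuous (grad phi).

Definition Lie_f (f : 'cV[R]_n -> 'cV[R]_n) phi x : R :=
  ((grad phi x)^T *m f x) 0 0.

Definition Lie_G (m : nat) (G : 'cV[R]_n -> 'M[R]_(n, m)) phi x : 'rV[R]_m :=
  (grad phi x)^T *m G x.

Definition positive_definite phi : Prop :=
  phi 0 = 0 /\ forall x, x != 0 -> 0 < phi x.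

End Calculus.

Section ControlFunctions.
Context {R : realType} {n m : nat}.
Variables (f : 'cV[R]_n -> 'cV[R]_n) (G : 'cV[R]_n -> 'M[R]_(n, m)).
Variable D : set 'cV[R]_n.

(* The infimum and the supremum are taken in the extended reals, since the
   expressions are unbounded in u where the Lie derivative along G is not 0. *)
Definition CLF (V : 'cV[R]_n -> R) (alpha_l : R -> R) : Prop :=
  [/\ C1 V, positive_definite V, classK alpha_l
    & forall x, (D `\ 0) x ->
        (ereal_inf [set (Lie_f f V x + (Lie_G G V x *m u) 0 0)%:E
                   | u in [set: 'cV[R]_m]]
         <= (- alpha_l (V x))%:E)%E].

Definition safe_set (h : 'cV[R]_n -> R) : set 'cV[R]_n := [set x | 0 <= h x].

Definition CBF (h : 'cV[R]_n -> R) (alpha_h : R -> R) : Prop :=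
  [/\ C1 h, extended_classK alpha_h
    & forall x, D x ->
        ((- alpha_h (h x))%:E
         <= ereal_sup [set (Lie_f f h x + (Lie_G G h x *m u) 0 0)%:E
                      | u in [set: 'cV[R]_m]])%E].

End ControlFunctions.

Section ControlLaw.
Context {R : realType} {n m : nat}.
Variables (f : 'cV[R]_n -> 'cV[R]_n) (G : 'cV[R]_n -> 'M[R]_(n, m)).
Variables (V : 'cV[R]_n -> R) (alpha_l : R -> R).
Variables (h : 'cV[R]_n -> R) (alpha_h : R -> R).
Variables (w_p : 'cV[R]_n -> 'cV[R]_m) (k : R).
Implicit Types x : 'cV[R]_n.

Definition F_l x : R := Lie_f f V x + alpha_l (V x).

Definition F_h x : R := Lie_f f h x + alpha_h (h x).

Definition w_l x : 'cV[R]_m := - (Lie_G G V x)^T.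

Definition w_h x : 'cV[R]_m := (Lie_G G h x)^T + k *: w_p x.

(* Division by 0 gives 0 here. If V is a CLF, the denominator is not 0 at any point
   of D other than 0 where 0 < F_l x. *)
Definition ubar_l x : R :=
  if 0 < F_l x then - (F_l x / (Lie_G G V x *m w_l x) 0 0) else 0.

Definition ubar_h x : R :=
  Num.max (- ((F_h x + (Lie_G G h x *m w_l x) 0 0 * ubar_l x)
              / (Lie_G G h x *m w_h x) 0 0)) 0.

Definition dcp_control x : 'cV[R]_m := ubar_l x *: w_l x + ubar_h x *: w_h x.

Definition closed_loop x : 'cV[R]_n := f x + G x *m dcp_control x.

Definition F_u x : 'cV[R]_n :=
  f x + G x *m (ubar_l x *: - (Lie_G G V x)^T + ubar_h x *: (Lie_G G h x)^T).

Definition Omega : set 'cV[R]_n :=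
  [set x | [/\ boundary (safe_set h) x,
               parallel (- F_u x) (G x *m w_p x) & F_u x != 0]].

Definition X_set : set 'cV[R]_n := [set x | Omega x /\ 0 < ubar_h x].

Definition Q_set (nu : R) : set 'cV[R]_n :=
  [set x | Omega x /\ 0 < ubar_h x < nu].

End ControlLaw.

(* Main.v *)
Require Import Defs.
From mathcomp Require Import ring lra.

Set Implicit Arguments.
Unset Strict Implicit.
Unset Printing Implicit Defensive.

Local Open Scope classical_set_scope.
Local Open Scope ring_scope.

(** Write u for the control and split the closed loop as
    F_u + (ubar_h * k) G w_p. At an equilibrium x <> 0 this sum vanishes, which
    is the claimed equation; the rest locates x, by testing the zero vector
    field against the gradients of V and of h.

    The safety filter is active, 0 < ubar_h x: otherwise the control is the nominal one,
    ubar_l w_l, under which V decreases at rate at least alpha_l (V x) > 0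
    ([Lie_nominal_le]); but at an equilibrium the derivative of V along the flow
    is 0.

    Where the filter is active, it makes the barrier condition an equality: the
    derivative of h along the flow is exactly - alpha_h (h x)
    ([Lie_active_filter], where the w_p part drops out because it is orthogonal
    to L_G h). At an equilibrium alpha_h (h x) = 0, so h x = 0.
    Since L_G h x <> 0, the gradient of h does not vanish at x, so x is not a
    local minimum of h and h takes negative values arbitrarily near x: x is on
    the boundary of the safe set ([boundary_safe_set]).

    The gain k is positive because X is nonempty, so the equation
    - F_u x = (ubar_h x * k) G w_p puts x in Omega, hence in X. Taking norms,
    ubar_h x * k * inf |G w_p| <= ubar_h x * k * |G w_p x| = |F_u x|
    <= sup |F_u| < k * nu * inf |G w_p|, that is, ubar_h x < nu. *)

Section Vectors.
Context {R : realType}.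

Lemma mulmx_trmx_gt0 (m : nat) (a : 'rV[R]_m) :
  a != 0 -> 0 < (a *m a^T) 0 0.
Proof.
move=> a0; rewrite mxE lt_neqAle sumr_ge0 ?andbT; last first.
  by move=> i _; rewrite mxE -expr2 sqr_ge0.
apply: contra a0; rewrite eq_sym psumr_eq0; last first.
  by move=> i _; rewrite mxE -expr2 sqr_ge0.
move=> /allP a0; apply/eqP/rowP => i; rewrite mxE.
have := a0 i (mem_index_enum i).
by rewrite mxE -expr2 sqrf_eq0 => /eqP.
Qed.

Lemma enorm_ge0 (n : nat) (v : 'cV[R]_n) : 0 <= enorm v.
Proof. exact: sqrtr_ge0. Qed.

Lemma enormZ (n : nat) (c : R) (v : 'cV[R]_n) :
  enorm (c *: v) = `|c| * enorm v.
Proof.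
rewrite /enorm -sqrtr_sqr -sqrtrM ?sqr_ge0// mulr_sumr; congr Num.sqrt.
by apply: eq_bigr => i _; rewrite mxE exprMn.
Qed.

End Vectors.

Section LocalMinimum.
Context {R : realType} {n : nat}.
Implicit Types (phi : 'cV[R]_n -> R) (x v : 'cV[R]_n).

(** At a local minimum the difference quotients in direction v are nonnegative
    for positive increments, hence so is their limit. *)
Lemma derive_local_min_ge0 phi x v :
  differentiable phi x -> (\forall y \near x, phi x <= phi y) ->
  0 <= 'D_v phi x.
Proof.
move=> dphi xmin.
have /cvg_dnbhs_at_right cvD :
    t^-1 *: ((phi \o shift x) (t *: v) - phi x) @[t --> (0 : R)^'] --> 'D_v phi x.
  exact: diff_derivable.
apply: (cvgr_to_ge cvD).
have line_cvg : t *: v + x @[t --> (0 : R)] --> x.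
  rewrite -[X in _ --> X]add0r -(scale0r v).
  by apply: cvgD; [apply: cvgZr_tmp; exact: cvg_id | exact: cvg_cst].
have {}xmin : \forall t \near (0 : R), phi x <= phi (t *: v + x).
  exact: line_cvg xmin.
near=> t.
apply: mulr_ge0.
  by rewrite invr_ge0 ltW//; near: t; exact: nbhs_right_gt.
rewrite subr_ge0/=; near: t.
exact: cvg_within xmin.
Unshelve. all: by end_near. Qed.

(** Applied to v and to - v, the one-sided bound makes every directional
    derivative vanish. *)
Lemma grad_local_min phi x :
  differentiable phi x -> (\forall y \near x, phi x <= phi y) ->
  grad phi x = 0.
Proof.
move=> dphi xmin; apply/colP => i; rewrite !mxE.
set v := delta_mx i 0.
apply/eqP; rewrite eq_le (derive_local_min_ge0 _ dphi xmin) andbT.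
have := derive_local_min_ge0 (- v) dphi xmin.
by rewrite !deriveE// linearN oppr_ge0.
Qed.

(** Were x interior to the safe set, the value 0 = h x would be a local minimum
    of h. *)
Lemma boundary_safe_set (h : 'cV[R]_n -> R) x :
  differentiable h x -> h x = 0 -> grad h x != 0 -> boundary (safe_set h) x.
Proof.
move=> dh hx0 gradh; split; first by apply: subset_closure; rewrite /safe_set/= hx0.
move=> x_int; case/eqP: gradh; apply: grad_local_min => //.
by rewrite hx0; exact: x_int.
Qed.

End LocalMinimum.

Section ClosedLoop.
Context {R : realType} {n m : nat}.
Variables (f : 'cV[R]_n -> 'cV[R]_n) (G : 'cV[R]_n -> 'M[R]_(n, m)).
Variables (V : 'cV[R]_n -> R) (alpha_l : R -> R).
Variables (h : 'cV[R]_n -> R) (alpha_h : R -> R).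
Variables (w_p : 'cV[R]_n -> 'cV[R]_m) (k : R).
Implicit Types (phi : 'cV[R]_n -> R) (x : 'cV[R]_n) (u : 'cV[R]_m).

Lemma Lie_control phi x u :
  Lie_f f phi x + (Lie_G G phi x *m u) 0 0
  = ((grad phi x)^T *m (f x + G x *m u)) 0 0.
Proof. by rewrite mulmxDr mulmxA [RHS]mxE. Qed.

Local Notation ul := (ubar_l f G V alpha_l).
Local Notation uh := (ubar_h f G V alpha_l h alpha_h w_p k).
Local Notation Fu := (F_u f G V alpha_l h alpha_h w_p k).

Lemma closed_loopE x :
  closed_loop f G V alpha_l h alpha_h w_p k x
  = Fu x + (uh x * k) *: (G x *m w_p x).
Proof.
rewrite /closed_loop /F_u /dcp_control /w_h -addrA; congr (_ + _).
by rewrite scalerDr scalerA addrA [LHS]mulmxDr -scalemxAr.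
Qed.

(** Where L_G V vanishes the control does not act on V, so the infimum in the
    definition of a CLF is L_f V itself and F_l <= 0; hence 0 < F_l makes the
    denominator in ubar_l nonzero. *)
Lemma Lie_nominal_le (D : set 'cV[R]_n) x :
  CLF f G D V alpha_l -> (D `\ 0) x ->
  Lie_f f V x + (Lie_G G V x *m (ul x *: w_l G V x)) 0 0 <= - alpha_l (V x).
Proof.
move=> [_ _ _ clf] Dx; rewrite /ubar_l; case: ltP => [Fl_gt0|Fl_le0]; last first.
  rewrite scale0r mulmx0 mxE addr0.
  by move: Fl_le0; rewrite /F_l; lra.
have LGV0 : Lie_G G V x != 0.
  apply/eqP => LGV0; have := clf x Dx.
  under eq_imagel do rewrite LGV0 mul0mx mxE addr0.
  rewrite ereal_inf_cst; last by apply/set0P; exists 0.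
  by rewrite lee_fin; move: Fl_gt0; rewrite /F_l; lra.
have LGVw0 : (Lie_G G V x *m w_l G V x) 0 0 != 0.
  by rewrite mulmxN mxE oppr_eq0 gt_eqF// mulmx_trmx_gt0.
by rewrite -scalemxAr [X in _ + X]mxE mulNr divfK// /F_l; lra.
Qed.

(** If 0 < ubar_h x, the maximum defining ubar_h is attained at the quotient, and
    ubar_h is the root of the affine equation saying that the barrier condition
    holds with equality. The denominator is |L_G h x|^2 > 0, as w_p is orthogonal
    to L_G h. *)
Lemma Lie_active_filter x :
  Lie_G G h x != 0 -> Lie_G G h x *m w_p x = 0 -> 0 < uh x ->
  Lie_f f h x
    + (Lie_G G h x *m dcp_control f G V alpha_l h alpha_h w_p k x) 0 0
  = - alpha_h (h x).
Proof.
move=> LGh0 orth uh_gt0.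
have LGhw0 : (Lie_G G h x *m w_h G h w_p k x) 0 0 != 0.
  by rewrite mulmxDr -scalemxAr orth scaler0 addr0 gt_eqF// mulmx_trmx_gt0.
have uhE : uh x = - ((F_h f h alpha_h x + (Lie_G G h x *m w_l G V x) 0 0 * ul x)
                     / (Lie_G G h x *m w_h G h w_p k x) 0 0).
  by move: uh_gt0; rewrite /ubar_h lt_max ltxx orbF => /ltW/max_idPl.
rewrite /dcp_control mulmxDr -!scalemxAr !mxE uhE.
move: LGhw0; rewrite /F_h !mxE => LGhw0; field.
exact: LGhw0.
Qed.

End ClosedLoop.

Theorem proposition5 (R : realType) (n m : nat)
    (f : 'cV[R]_n -> 'cV[R]_n) (G : 'cV[R]_n -> 'M[R]_(n, m))
    (D : set 'cV[R]_n)
    (V : 'cV[R]_n -> R) (alpha_l : R -> R)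
    (h : 'cV[R]_n -> R) (alpha_h : R -> R)
    (w_p : 'cV[R]_n -> 'cV[R]_m) (k nu : R)
    (Dopen : open D) (Dconn : connected D) (D0 : D 0)
    (f_lip : [locally [lipschitz f x | x in setT]])
    (G_lip : [locally [lipschitz G x | x in setT]])
    (f0 : f 0 = 0)
    (G_rank : forall x, (D `\ 0) x -> (2 <= \rank (G x))%N)
    (V_clf : CLF f G D V alpha_l)
    (h_cbf : CBF f G D h alpha_h)
    (safe_sub : safe_set h `<=` D)
    (h0 : 0 < h 0)
    (LGh_neq0 : forall x, D x -> Lie_G G h x != 0)
    (wp_lip : [locally [lipschitz w_p x | x in D]])
    (wp_orth : forall x, (D `\ 0) x -> Lie_G G h x *m w_p x = 0)
    (Gwp_neq0 : forall x, (D `\ 0) x -> G x *m w_p x != 0) :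
  let Fu := F_u f G V alpha_l h alpha_h w_p k in
  let uh := ubar_h f G V alpha_l h alpha_h w_p k in
  let X := X_set f G V alpha_l h alpha_h w_p k in
  let Q := Q_set f G V alpha_l h alpha_h w_p k nu in
  let normsFu := [set enorm (Fu x) | x in X] in
  let normsGwp := [set enorm (G x *m w_p x) | x in X] in
  X !=set0 ->
  0 < nu ->
  has_ubound normsFu ->
  0 < inf normsGwp ->
  sup normsFu / (nu * inf normsGwp) < k ->
  Q `<=` boundary (safe_set h) /\
  forall x, (D `\ 0) x ->
    closed_loop f G V alpha_l h alpha_h w_p k x = 0 ->
    Q x /\ - Fu x = (uh x * k) *: (G x *m w_p x).
Proof.
move=> Fu uh X Q normsFu normsGwp [x0 Xx0] nu_gt0 ubFu inf_gt0 k_gt.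
split=> [x [[]]//|x Dx].
have [xD /eqP x_neq0] := Dx.
have [[dh _] [_ alpha_h_mono alpha_h0] _] := h_cbf.
rewrite closed_loopE -/(Fu x) -/(uh x) => eqx.
have FuE : - Fu x = (uh x * k) *: (G x *m w_p x).
  by apply/eqP; rewrite eqr_oppLR -addr_eq0 eqx.
split=> //.
have stationary (phi : 'cV[R]_n -> R) : Lie_f f phi x
    + (Lie_G G phi x *m dcp_control f G V alpha_l h alpha_h w_p k x) 0 0 = 0.
  rewrite Lie_control -/(closed_loop f G V alpha_l h alpha_h w_p k x).
  by rewrite closed_loopE eqx mulmx0 mxE.
have uh_gt0 : 0 < uh x.
  have uh_ge0 : 0 <= uh x by rewrite /uh /ubar_h le_max lexx orbT.
  rewrite lt_neqAle uh_ge0 andbT; apply/eqP => uh0.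
  have [_ [_ V_gt0] [_ alpha_l_mono alpha_l0] _] := V_clf.
  have := alpha_l_mono 0 (V x) (lexx 0) (V_gt0 x x_neq0); rewrite alpha_l0.
  have := Lie_nominal_le V_clf Dx.
  have := stationary V; rewrite /dcp_control -/(uh x) -uh0 scale0r addr0 => ->.
  lra.
have hx0 : h x = 0.
  have := stationary h; rewrite Lie_active_filter ?LGh_neq0 ?wp_orth//.
  move/eqP; rewrite oppr_eq0 => /eqP alpha0.
  by case: (ltgtP (h x) 0) => // /alpha_h_mono; rewrite alpha0 alpha_h0 ltxx.
have bdx : boundary (safe_set h) x.
  apply: boundary_safe_set => //; apply: contra_neq (LGh_neq0 x xD).
  by rewrite /Lie_G => ->; rewrite trmx0 mul0mx.
have Fu_le y : X y -> enorm (Fu y) <= sup normsFu.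
  by move=> Xy; apply: ub_le_sup => //; exists y.
have k_gt0 : 0 < k.
  apply: le_lt_trans k_gt; apply: divr_ge0; last by rewrite mulr_ge0 ?ltW.
  exact: le_trans (enorm_ge0 _) (Fu_le x0 Xx0).
have c_gt0 : 0 < uh x * k by exact: mulr_gt0.
have Omx : Omega f G V alpha_l h alpha_h w_p k x.
  split=> //; first by exists (uh x * k).
  by rewrite -oppr_eq0 -/(Fu x) FuE scaler_eq0 gt_eqF//= Gwp_neq0.
have Xx : X x by split.
split=> //; rewrite -/(uh x) uh_gt0/=.
have Gwp_ge : inf normsGwp <= enorm (G x *m w_p x).
  apply: ge_inf; last by exists x.
  by exists 0 => _ [y _ <-]; exact: enorm_ge0.
have FuN : enorm (Fu x) = uh x * k * enorm (G x *m w_p x).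
  by rewrite -[Fu x]opprK FuE -scaleNr enormZ normrN gtr0_norm.
move: k_gt; rewrite ltr_pdivrMr ?mulr_gt0// => k_gt.
rewrite -(ltr_pM2r (mulr_gt0 k_gt0 inf_gt0)).
apply: (@le_lt_trans _ _ (enorm (Fu x))).
  by rewrite mulrA FuN ler_pM2l.
by apply: le_lt_trans (Fu_le x Xx) _; rewrite mulrCA.
Qed.
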